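(* Let $\alpha_1$ be a nonzero algebraic number and let $\alpha_2,\dots,\alpha_k$ be all the other Galois conjugates of $\alpha_1$, where $k\ge2$. Let $K$ be the Galois closure of $\mathbb{Q}(\alpha_1)$ and $d=[K:\mathbb{Q}]$ (so $d\ge k$). Let $b_1,\dots,b_k$ be integers (not necessarily distinct) with $b_1+\cdots+b_k=n\neq0$. If $$\mathrm{Tr}_{K/\mathbb{Q}}(b_1\alpha_1^j+\cdots+b_k\alpha_k^j)\in\mathbb{Z}\quad\text{for all } j=1,2,\dots,d+d\lfloor\log_2(|n|d)\rfloor+1,$$ then $\alpha_1$ is an algebraic integer, and hence so is each $\alpha_j$, $j\ge2$.
   Context: $\mathrm{Tr}_{K/\mathbb{Q}}$ is the field trace and $\lfloor\cdot\rfloor$ the integer part. *)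

(* Defs.v *)
From HB Require Import structures.
From mathcomp Require Import all_boot all_order all_algebra all_fingroup all_field.
Set Implicit Arguments. Unset Strict Implicit. Unset Printing Implicit Defensive.
Import GRing.Theory Num.Theory.
Local Open Scope ring_scope.

Definition is_alg_int (L : fieldExtType rat) (x : L) : Prop :=
  exists p : {poly int}, p \is monic /\ root (map_poly (fun z : int => z%:~R) p) x.

(* Main.v *)
Require Import Defs.
From HB Require Import structures.
From mathcomp Require Import all_boot all_order all_algebra all_fingroup all_field.
From mathcomp Require Import ring zify.
Set Implicit Arguments. Unset Strict Implicit. Unset Printing Implicit Defensive.
Import GRing.Theory Num.Theory.
Local Open Scope ring_scope.

(** All conjugates have the same trace, so the hypothesis says that the numbers
    [S_j := m * \sum_i alpha_i ^ j], with [m = n * (d / k)], are integers for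
    [1 <= j <= N].  Let [h] be the reversal of the primitive integer multiple of
    the minimal polynomial.  By Newton's identities the series [S] satisfies
    [h * S = - m * 'X * h'] up to degree [N].  If [a1] is not integral, some prime
    [p] divides [h_0]; let [r] be the least index with [p] not dividing [h_r].
    By Hensel lifting (Weierstrass preparation) modulo a power of [p], one may
    replace [h] by a monic [h1] of degree [r] with [h1 = 'X^r] modulo [p]; then
    the right-hand side has degree [r], which forces [p ^ t] to divide the new
    [S_j] for [j <= N - r * t], and the coefficient of ['X^r] gives
    [p ^ t.+1 %| m * r] as long as [r + r * t <= N].  This is absurd for
    [t = v_p (m * r) <= log_2 (|n| * d)]. *)

(** * Integer polynomials modulo a prime power and a power of ['X] *)

Lemma dvdz_poly_factor (q : int) (f : {poly int}) :
  (forall i, (q %| f`_i)%Z) -> exists a, f = q%:P * a.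
Proof.
move=> dvf; exists (\poly_(i < size f) (f`_i %/ q)%Z).
apply/polyP=> i; rewrite coefCM coef_poly; case: ltnP => [_|le_fi].
  by rewrite mulrC divzK.
by rewrite mulr0 nth_default.
Qed.

(** Such an [f] lies in the ideal generated by [q] and ['X], whose [n]-th power lies in the one
    generated by [q] and ['X^n]. *)
Lemma poly_pow_mod (q : int) (n : nat) (f : {poly int}) :
  (q %| f`_0)%Z -> exists a b, f ^+ n = q%:P * a + 'X^n * b.
Proof.
move=> /dvdzP[c f0].
have fE : f = q%:P * c%:P + 'X * drop_poly 1 f.
  rewrite -{1}(poly_take_drop 1 f) expr1 [drop_poly 1 f * _]mulrC; congr (_ + _).
  apply/polyP=> i; rewrite coef_take_poly -rmorphM coefC.
  by case: i => [|i] //=; rewrite f0 mulrC.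
set d := drop_poly 1 f in fE.
elim: n => [|n [a [b IHn]]]; first by exists 0, 1; rewrite !expr0; ring.
exists (a * f + 'X^n * b * c%:P), (b * d).
by rewrite [f ^+ _]exprSr IHn mulrDl {2}fE exprS; ring.
Qed.

(** If [u] inverts the constant term of [U] modulo [q], then [1 - u U] has constant term divisible
    by [q], so its [n]-th power vanishes modulo [q] and ['X^n]; the geometric sum then gives the
    inverse. *)
Lemma coprimez_series_inv (q : int) (n : nat) (U : {poly int}) :
  coprimez U`_0 q -> exists V a b, U * V = 1 + q%:P * a + 'X^n * b.
Proof.
case/coprimezP=> -[u v] /= uvE.
have [a [b fE]] : exists a b, (1 - u%:P * U) ^+ n = q%:P * a + 'X^n * b.
  apply: poly_pow_mod; rewrite coefB coef1 coefCM /=.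
  by apply/dvdzP; exists v; rewrite -uvE; ring.
have := subrX1 (1 - u%:P * U) n; rewrite fE.
set s := \sum_(_ < _) _ => sE.
exists (u%:P * s), (- a), (- b).
have -> : U * (u%:P * s) = 1 - (q%:P * a + 'X^n * b - 1) - 1 by rewrite sE; ring.
by ring.
Qed.

(* Hensel lifting of [h = 'X^r * U mod p]; the distinguished factor is written
   ['X^r + p * w] so that its lower coefficients stay divisible by [p]. *)
Lemma weierstrass_factor (p r e : nat) (h : {poly int}) :
  prime p -> (forall i, (i < r)%N -> (p %| h`_i)%Z) -> ~~ (p %| h`_r)%Z ->
  exists w U a : {poly int},
    [/\ (size w <= r)%N, coprimez U`_0 p
      & h = ('X^r + p%:Z%:P * w) * U + (p ^ e.+1)%N%:Z%:P * a].
Proof.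
move=> p_pr dvh ndvh; elim: e => [|e [w [U [R [sw cU hE]]]]].
  have [a aE] : exists a, take_poly r h = p%:Z%:P * a.
    apply: dvdz_poly_factor => i; rewrite coef_take_poly.
    by case: ifP => [/dvh|]; rewrite ?dvdz0.
  exists 0, (drop_poly r h), a; split; rewrite ?size_poly0 //.
    rewrite coef_drop_poly add0n coprimezE coprime_sym prime_coprime //.
  by rewrite -{1}(poly_take_drop r h) aE expn1; ring.
(* Weierstrass division of the error [R] by the distinguished factor, modulo [p]: [A] will correct
   [w], and its degree below [r] keeps that factor monic, while [b'] will correct [U]. *)
have [V [a [b UV]]] := coprimez_series_inv r cU.
pose A := take_poly r (V * R); pose D := drop_poly r (V * R).
have VR : V * R = A + D * 'X^r by rewrite poly_take_drop.
pose b' := D * U - b * R.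
pose a' := - a * R - w * b'.
have RE : R - A * U = p%:Z%:P * a' + ('X^r + p%:Z%:P * w) * b'.
  have -> : A = V * R - D * 'X^r by rewrite VR; ring.
  have -> : R - (V * R - D * 'X^r) * U = R - R * (U * V) + D * 'X^r * U by ring.
  by rewrite UV /a' /b'; ring.
exists (w + (p ^ e)%N%:Z%:P * A), (U + (p ^ e.+1)%N%:Z%:P * b').
exists (a' - (p ^ e)%N%:Z%:P * A * b'); split.
- rewrite (leq_trans (size_polyD _ _)) // geq_max sw /=.
  by rewrite mul_polyC (leq_trans (size_scale_leq _ _)) // size_take_poly.
- rewrite coefD coefCM expnS PoszM -mulrA addrC mulrC.
  by rewrite /coprimez gcdzC gcdzMDl gcdzC.
rewrite hE; have -> : R = p%:Z%:P * a' + ('X^r + p%:Z%:P * w) * b' + A * U.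
  by rewrite -RE; ring.
by rewrite !expnS !PoszM !rmorphM /=; ring.
Qed.

(* Multiplying by the inverse of the unit factor of [h] reduces to a monic
   distinguished [h1] of degree [r], for which the right-hand side of
   [h1 * S1 = - m * 'X * h1'] has degree [r]: comparing coefficients beyond [r]
   gains a factor [p] in [S1] at the cost of [r] terms. *)
Lemma log_deriv_dvd (p r t N : nat) (m : int) (h S : {poly int}) :
  prime p -> (forall i, (i < r)%N -> (p %| h`_i)%Z) -> ~~ (p %| h`_r)%Z ->
  (0 < r)%N -> (r + r * t <= N)%N -> S`_0 = 0 ->
  (forall i, (i <= N)%N -> (h * S + m%:P * 'X * h^`())`_i = 0) ->
  ((p ^ t.+1)%N %| m * r)%Z.
Proof.
move=> p_pr dvh ndvh r_gt0 leN S0 hS.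
have [B BE] : exists B, h * S + m%:P * 'X * h^`() = 'X^(N.+1) * B.
  exists (drop_poly N.+1 (h * S + m%:P * 'X * h^`())).
  rewrite -{1}(poly_take_drop N.+1 (_ + _)) [X in X + _ = _](_ : _ = 0).
    by rewrite add0r mulrC.
  apply/polyP=> i; rewrite coef_take_poly coef0.
  by case: ltnP => // /hS.
have [w [U [a [sw cU hE]]]] := weierstrass_factor t p_pr dvh ndvh.
set q : int := (p ^ t.+1)%N in hE *.
have cUq : coprimez U`_0 q.
  by rewrite coprimezE /q /= coprimeXr -?coprimezE.
have [V [a1 [b1 UV]]] := coprimez_series_inv N.+1 cUq.
set h1 := 'X^r + p%:Z%:P * w in hE.
(* Modulo [q] and ['X^(N.+1)] this is [S + m 'X U' / U]: the logarithmic derivative of [U] moves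
   from the right-hand side into the series. *)
pose S1 := V * (U * S + m%:P * 'X * U^`()).
have S10 : S1`_0 = 0.
  by rewrite /S1 coef0M coefD coef0M S0 -mulrA coefCM coefXM /= !(mulr0, addr0).
have [A [C ACE]] : exists A C,
    h1 * S1 + m%:P * 'X * h1^`() = q%:P * A + 'X^(N.+1) * C.
  have h'E : h^`() = h1^`() * U + h1 * U^`() + q%:P * a^`().
    by rewrite hE derivD !derivM derivC; ring.
  have h1U : h1 * U = h - q%:P * a by rewrite hE; ring.
  have h1U' : h1 * U^`() = h^`() - h1^`() * U - q%:P * a^`() by rewrite h'E; ring.
  have -> : h1 * S1 + m%:P * 'X * h1^`() =
      V * ((h1 * U) * S + m%:P * 'X * (h1 * U^`())) + m%:P * 'X * h1^`().
    by rewrite /S1; ring.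
  rewrite h1U h1U'.
  have -> : V * ((h - q%:P * a) * S + m%:P * 'X * (h^`() - h1^`() * U - q%:P * a^`()))
      + m%:P * 'X * h1^`() =
      V * (h * S + m%:P * 'X * h^`()) - q%:P * (V * (a * S + m%:P * 'X * a^`()))
      + m%:P * 'X * h1^`() * (1 - U * V) by ring.
  rewrite BE UV; exists (- (V * (a * S + m%:P * 'X * a^`())) - m%:P * 'X * h1^`() * a1).
  by exists (V * B - m%:P * 'X * h1^`() * b1); ring.
have coefE1 i : (r <= i <= N)%N ->
    S1`_(i - r) + p%:Z * (w * S1)`_i + m * (if i == r then r%:Z else 0) = q * A`_i.
  case/andP=> le_ri le_iN; have /(congr1 (fun f : {poly int} => f`_i)) := ACE.
  rewrite mulrDl -!mulrA !(coefD, coefCM, coefXnM, coefXM) ltnS le_iN ltnNge le_ri /=.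
  rewrite addr0 => <-; congr (_ + _ * _).
  case: i le_ri {le_iN} => [|i] le_ri /=; first by move: r_gt0; rewrite lt0n -leqn0 le_ri.
  rewrite coef_deriv coefD coefXn coefCM.
  rewrite (nth_default _ (leq_trans sw le_ri)) mulr0 addr0.
  by case: eqP => [->|_]; rewrite ?mul0rn // natz.
have dvd_wS s i : (forall l, (l <= i)%N -> ((p ^ s)%N %| S1`_l)%Z) ->
    ((p ^ s.+1)%N %| p%:Z * (w * S1)`_i)%Z.
  move=> dvS; rewrite expnS PoszM dvdz_mul // coefMr.
  by apply: rpred_sum => l _; rewrite dvdz_mull // dvS // -ltnS.
have dvS s : (s <= t)%N -> forall i, (i + r * s <= N)%N -> ((p ^ s)%N %| S1`_i)%Z.
  elim: s => [|s IHs] le_st i le_iN; first by rewrite expn0 dvd1z.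
  case: i le_iN => [|i] le_iN; first by rewrite S10 dvdz0.
  have le_irN : (r <= i.+1 + r <= N)%N by nia.
  have := coefE1 _ le_irN; rewrite addnK.
  have -> : (i.+1 + r == r)%N = false by lia.
  rewrite mulr0 addr0 => /(canRL (addrK _)) ->.
  rewrite rpredB //.
    by rewrite dvdz_mulr // /q; apply: dvdn_exp2l; lia.
  by apply: dvd_wS => l le_l; apply: IHs; nia.
(* In degree [r] the term of [S1] is its constant coefficient, which is 0, so [m * r] is left alone
   against multiples of [p ^ t.+1]. *)
have := coefE1 r; rewrite leqnn subnn eqxx S10 add0r.
move=> /(_ (leq_trans (leq_addr _ _) leN)).
rewrite addrC => /(canRL (addrK _)) ->.
rewrite rpredB //; first by rewrite dvdz_mulr.
by apply: dvd_wS => l le_l; apply: dvS => //; lia.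
Qed.

(** * Newton's identities and reversed polynomials *)

(** Logarithmic differentiation of the product: the factor of [x] contributes the geometric series
    [x 'X / (1 - x 'X)], truncated after degree [N]. *)
Lemma newton_log_deriv (R : comNzRingType) (s : seq R) (N : nat) :
  exists B, (\prod_(x <- s) (1 - x *: 'X)) *
              (\sum_(x <- s) 'X * \poly_(j < N) x ^+ j.+1) =
            - 'X * (\prod_(x <- s) (1 - x *: 'X))^`() + 'X^(N.+1) * B.
Proof.
elim: s => [|x s [B IHs]].
  by exists 0; rewrite !big_nil derivC; ring.
rewrite !big_cons; move: IHs.
set g := \prod_(_ <- _) _; set P := \sum_(_ <- _) _ => IHs.
have xP : (1 - x *: 'X) * ('X * \poly_(j < N) x ^+ j.+1)
    = x *: 'X - 'X^(N.+1) * (x ^+ N.+1)%:P.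
  have -> : 'X * \poly_(j < N) x ^+ j.+1 = x *: 'X * \sum_(j < N) (x *: 'X) ^+ j.
    rewrite poly_def !big_distrr; apply: eq_bigr => j _ /=.
    by rewrite exprZn exprS -!mul_polyC !polyCM /=; ring.
  have /(congr1 (fun f => - (x *: 'X * f))) := subrX1 (x *: 'X) N.
  rewrite exprZn -!mul_polyC => E.
  transitivity (- (x%:P * 'X * ((x%:P * 'X - 1) * \sum_(i < N) (x%:P * 'X) ^+ i))).
    by ring.
  by rewrite -E !exprS polyCM; ring.
exists ((1 - x *: 'X) * B - (x ^+ N.+1)%:P * g).
rewrite derivM derivB derivC derivZ derivX.
have -> : (1 - x *: 'X) * g * ('X * \poly_(j < N) x ^+ j.+1 + P) =
  g * ((1 - x *: 'X) * ('X * \poly_(j < N) x ^+ j.+1)) + (1 - x *: 'X) * (g * P).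
  by ring.
by rewrite xP IHs -!mul_polyC; ring.
Qed.

Lemma coef_prod_1subX (R : comNzRingType) (s : seq R) (i : nat) :
  (\prod_(x <- s) (1 - x *: 'X))`_i =
  if (i <= size s)%N then (\prod_(x <- s) ('X - x%:P))`_(size s - i) else 0.
Proof.
elim: s i => [|x s IHs] i; first by rewrite !big_nil !coef1; case: i.
rewrite !big_cons mulrBl mul1r coefB -scalerAl coefZ coefXM !IHs.
rewrite mulrBl coefB coefXM coefCM /=.
have szs : (\prod_(x <- s) ('X - x%:P))`_(size s).+1 = 0.
  by rewrite nth_default // size_prod_XsubC.
case: i => [|i] /=.
  by rewrite !subn0 szs.
rewrite ltnS subSS; case: (ltngtP i (size s)) => [lt_is||->].
- by rewrite subn_eq0 leqNgt lt_is /= subnS.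
- by move=> _; rewrite mulr0 subr0.
by rewrite subnn /=.
Qed.

(** * Integrality of roots from integral multiples of power sums *)

Lemma primitive_int_poly (f : {poly rat}) : f \is monic ->
  exists2 h : {poly int},
    [/\ 0 < lead_coef h, size h = size f
      & (lead_coef h)%:~R *: f = map_poly intr h]
    & forall p : nat, prime p -> exists i, ~~ (p %| h`_i)%Z.
Proof.
move=> f_mon; have [q [a a_neq0 fE]] := rat_poly_scale f.
have q_neq0 : q != 0.
  apply: contraTneq f_mon => q0.
  by rewrite fE q0 rmorph0 scaler0 monicE lead_coef0 eq_sym oner_eq0.
have injq : injective (intr : int -> rat) by exact: intr_inj.
have size_map g : size (map_poly (intr : int -> rat) g) = size g.
  exact: size_map_inj_poly.
have ca_neq0 : (zcontents q)%:~R / a%:~R != 0 :> rat.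
  by rewrite mulf_neq0 ?invr_eq0 ?intr_eq0 // zcontents_eq0.
have fE' : f = ((zcontents q)%:~R / a%:~R) *: map_poly intr (zprimitive q).
  by rewrite fE [in LHS](zpolyEprim q) map_polyZ /= scalerA mulrC.
exists (zprimitive q).
  split.
  - by rewrite -sgz_gt0 sgz_lead_primitive q_neq0.
  - by rewrite fE' size_scale // size_map.
  rewrite [in LHS]fE' scalerA.
  rewrite (_ : _ * _ = 1) ?scale1r //.
  move: f_mon; rewrite fE' monicE lead_coefZ lead_coef_map_inj // => /eqP.
  by rewrite mulrC.
move=> p p_pr.
case: (boolP [forall i : 'I_(size (zprimitive q)), (p %| (zprimitive q)`_i)%Z]).
  move/forallP=> dvq.
  have /polyOverP : forall i, (p %| (zprimitive q)`_i)%Z.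
    move=> i; case: (ltnP i (size (zprimitive q))) => [lt_i|le_i].
      exact: (dvq (Ordinal lt_i)).
    by rewrite nth_default ?dvdz0.
  rewrite -dvdz_contents zcontents_primitive q_neq0 dvdz1 /= => /eqP p1.
  by move: p_pr; rewrite p1.
by rewrite negb_forall => /existsP[i ndv]; exists i.
Qed.

Lemma ratext_intr_eq0 (L : fieldExtType rat) (z : int) :
  (z%:~R == 0 :> L) = (z == 0).
Proof. by rewrite -(rmorph_int (in_alg L)) fmorph_eq0 intr_eq0. Qed.

Lemma alg_int_of_power_sums (L : fieldExtType rat) (s : seq L)
    (f : {poly rat}) (m : int) (N : nat) :
  \prod_(x <- s) ('X - x%:P) = map_poly (in_alg L) f -> m != 0 ->
  (size s + size s * trunc_log 2 (`|m| * size s) <= N)%N ->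
  (forall j, (1 <= j <= N)%N ->
     exists z : int, m%:~R * \sum_(x <- s) x ^+ j = z%:~R) ->
  {in s, forall x, is_alg_int x}.
Proof.
move=> fE m_neq0 leN intS.
have f_mon : f \is monic.
  by rewrite -(map_monic (in_alg L)) -fE monic_prod_XsubC.
have szf : size f = (size s).+1.
  by rewrite -(size_map_poly (in_alg L)) -fE size_prod_XsubC.
have [h0 [c_gt0 szh0 h0E] primh0] := primitive_int_poly f_mon.
have h0LE : (lead_coef h0)%:~R *: \prod_(x <- s) ('X - x%:P)
    = map_poly (intr : int -> L) h0.
  have /(congr1 (map_poly (in_alg L))) := h0E.
  rewrite map_polyZ rmorph_int fE => ->.
  rewrite -map_poly_comp; apply: eq_map_poly => z /=.
  exact: (rmorph_int (in_alg L)).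
have [c1|c_neq1] := eqVneq (lead_coef h0) 1.
  move=> x xs; exists h0; split; first by rewrite monicE c1.
  by rewrite -h0LE c1 scale1r root_prod_XsubC.
set k := size s in leN szf.
set c := lead_coef h0 in c_gt0 h0LE c_neq1.
(* A prime factor of the leading coefficient of [h0] divides the constant term of its reversal [h],
   which makes [r] positive. *)
pose p := pdiv `|c|.
have p_pr : prime p by apply: pdiv_prime; lia.
have dvpc : (p %| c)%Z by rewrite dvdzE /= pdiv_dvd.
pose h := \poly_(i < k.+1) h0`_(k - i).
pose g := \prod_(x <- s) (1 - x *: 'X).
have hLE : map_poly intr h = c%:~R *: g.
  apply/polyP=> i; rewrite coef_map coefZ coef_poly coef_prod_1subX ltnS -/k.
  case: ifP => _; last by rewrite mulr0.
  by rewrite -coefZ h0LE coef_map.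
have exr : exists i, ~~ (p %| h`_i)%Z.
  have [i ndv] := primh0 p p_pr; exists (k - i)%N.
  have le_ik : (i <= k)%N.
    rewrite leqNgt; apply: contra ndv => lt_ki.
    by rewrite nth_default ?dvdz0 // szh0 szf.
  by rewrite coef_poly ltnS leq_subr subKn.
pose r := ex_minn exr.
have [ndvr minr] : ~~ (p %| h`_r)%Z /\ forall i, (i < r)%N -> (p %| h`_i)%Z.
  rewrite /r; case: ex_minnP => j ndv minj; split=> // i.
  by rewrite ltnNge; apply: contraNT => /minj.
have le_rk : (r <= k)%N.
  rewrite leqNgt; apply: contra ndvr => lt_kr.
  by rewrite nth_default ?dvdz0 // (leq_trans (size_poly _ _)).
have r_gt0 : (0 < r)%N.
  rewrite lt0n; apply: contra ndvr => /eqP ->.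
  by rewrite coef_poly /= subn0 -[k]/k.+1.-1 -szf -szh0.
(* With [t] the exact valuation of [m * r], divisibility by [p ^ t.+1] is absurd. The size of [t]
   follows from [2 ^ t <= p ^ t <= |m| r <= |m| k]. *)
pose t := logn p `|(m * r)%R|%N.
have mr_gt0 : (0 < `|(m * r)%R|)%N by rewrite absz_gt0 mulf_neq0 // -lt0n.
have le_t : (t <= trunc_log 2 (`|m| * k))%N.
  apply: trunc_log_max => //.
  apply: (@leq_trans (p ^ t)).
    by case: (t) => // t'; rewrite leq_exp2r // prime_gt1.
  apply: (@leq_trans `|(m * r)%R|%N).
    by rewrite dvdn_leq // pfactor_dvdnn.
  by rewrite abszM leq_mul2l le_rk orbT.
have leNr : (r + r * t <= N)%N.
  by apply: leq_trans leN; rewrite leq_add // leq_mul.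
have /fin_all_exists[z zE] (i : 'I_N) :
    exists z : int, m%:~R * \sum_(x <- s) x ^+ i.+1 = z%:~R.
  by apply: intS; rewrite /= ltn_ord.
(* [z i] belongs to the power [i.+1], hence the shift by ['X]; the default 0 is never reached below
   [N]. *)
pose S := 'X * \poly_(i < N) (if insub i is Some j then z j else 0).
have [B newton] := newton_log_deriv s N; rewrite -/g in newton.
set P := \sum_(_ <- _) _ in newton.
have SE i : (i <= N)%N -> (map_poly intr S)`_i = m%:~R * P`_i :> L.
  rewrite coef_map coefXM coef_sum; case: i => [|i] lt_iN /=.
    by rewrite big1 ?mulr0 // => x _; rewrite coefXM.
  rewrite coef_poly lt_iN insubT /= -zE; congr (_ * _).
  by apply: eq_bigr => x _; rewrite coefXM coef_poly lt_iN.
have S0 : S`_0 = 0 by rewrite coefXM.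
clearbody S.
suff : ((p ^ t.+1)%N %| m * r)%Z.
  by rewrite dvdzE /= pfactor_dvdn // ltnn.
apply: (log_deriv_dvd (h := h) (S := S) (N := N)) => // i le_iN; apply/eqP; rewrite -(ratext_intr_eq0 L).
rewrite -(coef_map (intr : int -> L)) rmorphD !rmorphM /= map_polyC map_polyX /=.
rewrite -deriv_map hLE derivZ coefD.
have -> : (c%:~R *: g * map_poly intr S)`_i = (c%:~R *: (m%:~R *: (g * P)))`_i.
  rewrite !coefZ -scalerAl coefZ; congr (_ * _).
  rewrite !coefM big_distrr; apply: eq_bigr => j _.
  by rewrite SE ?(leq_trans (leq_subr _ _)) //=; ring.
rewrite newton -coefD -!mul_polyC.
rewrite (_ : _ + _ = 'X^(N.+1) * (c%:~R%:P * m%:~R%:P * B)); last by ring.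
by rewrite coefXnM ltnS le_iN.
Qed.

(** * Traces of combinations of conjugates, and conclusion *)

(** Conjugates have equal traces, so [k] times the trace of [a1 ^+ j] is the trace of the power sum,
    which is Galois invariant and hence just multiplied by [\dim K]. *)
Lemma galTrace_conj_comb (L : splittingFieldType rat) (a1 : L) (k : nat)
    (alpha : 'I_k -> L) (K : {subfield L}) (b : 'I_k -> int) (j : nat) :
  injective alpha ->
  minPoly 1%VS a1 = \prod_(i < k) ('X - (alpha i)%:P) ->
  splittingFieldFor 1%VS (minPoly 1%VS a1) K ->
  (k %| \dim K)%N /\
  galTrace 1%VS K (\sum_(i < k) (b i)%:~R * alpha i ^+ j) =
  ((\sum_(i < k) b i) * (\dim K %/ k)%N)%:~R * \sum_(i < k) alpha i ^+ j.
Proof.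
move=> inj_alpha fE splitK.
pose s := [seq alpha i | i <- index_enum 'I_k].
have fEs : minPoly 1%VS a1 = \prod_(x <- s) ('X - x%:P) by rewrite big_map.
have f_over := minPolyOver 1%AS a1.
have galK : galois 1%AS K.
  apply/splitting_galoisField; exists (minPoly 1%VS a1); split => //.
  by rewrite fEs separable_prod_XsubC map_inj_uniq // index_enum_uniq.
have rootK x : root (minPoly 1%VS a1) x -> x \in K.
  case: splitK => rs eqf <-; rewrite (eqp_root eqf) root_prod_XsubC.
  exact: seqv_sub_adjoin.
have root_alpha i : root (minPoly 1%VS a1) (alpha i).
  by rewrite fEs root_prod_XsubC map_f // mem_index_enum.
have Ka1 : a1 \in K by apply: rootK; apply: (root_minPoly 1%AS).
have dimk : \dim <<1%AS; a1>> = k.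
  rewrite dim_Fadjoin dimv1 muln1; apply: succn_inj.
  by rewrite -size_minPoly fEs size_prod_XsubC size_map [index_enum _]unlock -enumT size_enum_ord.
have k_dvd : (k %| \dim K)%N.
  by rewrite -[X in (X %| _)%N]dimk field_dimS //; apply/FadjoinP; rewrite sub1v.
split=> //.
have trE i : galTrace 1%VS K (alpha i ^+ j) = galTrace 1%VS K (a1 ^+ j).
  have [sub1K _ normK] := and3P galK.
  have [/= x galx <-] := normalField_root_minPoly sub1K normK Ka1 (root_alpha i).
  by rewrite -rmorphXn /= (galTrace_gal (K := 1%AS)) // rpredX.
have sumE : k%:R * galTrace 1%VS K (a1 ^+ j) =
    (\dim K)%:R * \sum_(i < k) alpha i ^+ j.
  transitivity (galTrace 1%VS K (\sum_(i < k) alpha i ^+ j)).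
    rewrite raddf_sum (eq_bigr _ (fun i _ => trE i)) sumr_const card_ord.
    by rewrite mulr_natl.
  rewrite /galTrace (eq_bigr (fun=> \sum_(i < k) alpha i ^+ j)).
    by rewrite sumr_const -(galois_dim galK) dimv1 divn1 mulr_natl.
  move=> x galx; rewrite rmorph_sum /=.
  (* An automorphism fixes the minimal polynomial, so it permutes the roots. *)
  have : perm_eq (map x s) s.
    apply: prod_XsubC_eq; rewrite -fEs -[RHS](fixedPoly_gal (sub1v K) galx f_over).
    by rewrite fEs map_prod_XsubC big_map.
  move=> eqs.
  have : \sum_(y <- map x s) y ^+ j = \sum_(y <- s) y ^+ j by apply: perm_big.
  by rewrite !big_map => <-; apply: eq_bigr => i _; rewrite rmorphXn.
have k_neq0 : k%:R != 0 :> L.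
  rewrite -[k%:R]/(k%:Z%:~R) ratext_intr_eq0 -lt0n -dimk adim_gt0 //.
have trE' : galTrace 1%VS K (a1 ^+ j) =
    (\dim K %/ k)%N%:R * \sum_(i < k) alpha i ^+ j.
  apply: (mulfI k_neq0); rewrite sumE -{1}(divnK k_dvd) natrM; ring.
rewrite raddf_sum (eq_bigr (fun i => (b i)%:~R * galTrace 1%VS K (a1 ^+ j))).
  by rewrite -mulr_suml -rmorph_sum trE' rmorphM /= mulrA.
by move=> i _; rewrite -(trE i) !mulrzl; apply: raddfMz.
Qed.

Theorem theorem2p10 (L : splittingFieldType rat) (a1 : L) (k : nat)
    (alpha : 'I_k -> L) (K : {subfield L}) (b : 'I_k -> int) :
  a1 != 0 ->
  (2 <= k)%N ->
  injective alpha ->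
  minPoly 1%VS a1 = \prod_(i < k) ('X - (alpha i)%:P) ->
  splittingFieldFor 1%VS (minPoly 1%VS a1) K ->
  let d := \dim K in
  let n := \sum_(i < k) b i in
  n != 0 ->
  (forall j : nat, (1 <= j <= d + d * trunc_log 2 (`|n|%N * d) + 1)%N ->
     exists z : int,
       galTrace 1%VS K (\sum_(i < k) (b i)%:~R * alpha i ^+ j) = z%:~R) ->
  is_alg_int a1 /\ (forall i : 'I_k, is_alg_int (alpha i)).
Proof.
move=> _ _ inj_alpha fE splitK d n n_neq0 intTr.
have [k_dvd _] := galTrace_conj_comb b 0 inj_alpha fE splitK.
have trE j := proj2 (galTrace_conj_comb b j inj_alpha fE splitK).
have d_gt0 : (0 < d)%N by apply: adim_gt0.
pose s := [seq alpha i | i <- index_enum 'I_k].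
have fEs : minPoly 1%VS a1 = \prod_(x <- s) ('X - x%:P) by rewrite big_map.
have szs : size s = k by rewrite size_map [index_enum _]unlock -enumT size_enum_ord.
have [f fQ] := polyOver1P (minPolyOver 1%AS a1).
have m_neq0 : n * (d %/ k)%N != 0.
  apply: mulf_neq0 n_neq0 _; rewrite eqz_nat -lt0n divn_gt0.
    exact: dvdn_leq d_gt0 k_dvd.
  exact: dvdn_gt0 d_gt0 k_dvd.
have ints : {in s, forall x, is_alg_int x}.
  apply: (alg_int_of_power_sums (etrans (esym fEs) fQ) m_neq0); last first.
    by move=> j /intTr[z trz]; exists z; rewrite big_map -trE.
  (* For [m = n * (d / k)] one has [|m| * k = |n| * d], the argument of the logarithm in the
     hypothesis; [k <= d] handles the rest. *)
  have le_kd := dvdn_leq d_gt0 k_dvd.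
  rewrite szs abszM -mulnA (divnK k_dvd).
  exact: leq_trans (leq_add le_kd (leq_mul le_kd (leqnn _))) (leq_addr _ _).
split=> [|i]; apply: ints; last by rewrite map_f ?mem_index_enum.
by rewrite -root_prod_XsubC -fEs (root_minPoly 1%AS).
Qed.
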